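(* Let $G$ be a finite partial graph equipped with a local coloring $\mathsf{c}$, and let $P$ be a set of vertex-color pairs of $G$ which dominates cusp-points. If $G$ has no cusp-free cycle, then for every element $(v,\alpha)\in P$ that is maximal in $P$ for the relation $\lhd$ restricted to $P$, the vertex $v$ is splitting.
   Context: A (finite, undirected, multi) partial graph is a triple $(\mathcal V,\mathcal E,\psi)$ of disjoint finite sets of vertices $\mathcal V$ and edges $\mathcal E$ and an incidence function $\psi$ assigning to each edge a set of at most two vertices (its endpoints). A path is a finite alternating sequence $(v_0,e_1,v_1,\dots,e_n,v_n)$ ($n\ge 0$) such that for each $i$ the endpoints of $e_i$ are exactly $v_{i-1}$ and $v_i$, which are distinct. It is simple if its edges are pairwise distinct and its vertices are pairwise distinct except possibly $v_0=v_n$; closed if $v_0=v_n$, open otherwise. A cycle is a simple closed path with at least one edge. A local coloring is a function $\mathsf c$ assigning to each pair $(e,v)$, with $v$ an endpoint of the edge $e$, a color in a finite set $\mathsf C$. A cusp is a triple $(e,v,f)$ of two distinct edges $e,f$ both incident to $v$ with $\mathsf c(e,v)=\mathsf c(f,v)$; its vertex is $v$, its color is this common color $\alpha$, and $(v,\alpha)$ is then called a cusp-point. A vertex-color pair is any element of $\mathcal V\times\mathsf C$. A cusp of a path is a cusp $(e_i,v_i,e_{i+1})$ formed by consecutive elements of the path, or, if the path is closed, the cusp $(e_n,v_0,e_1)$. A path is cusp-free if it has no cusp. For a path with at least one edge, its starting color is $\mathsf c(e_1,v_0)$ and its ending color is $\mathsf c(e_n,v_n)$. A vertex $v$ is splitting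 if every cycle containing $v$ has a cusp at $v$ (i.e., the two edges of the cycle adjacent to $v$ form a cusp). Write $(v,\alpha)\to_p(u,\beta)$ if $p$ is a simple open cusp-free path from $v$ to $u$ whose starting color is not $\alpha$ and whose ending color is $\beta$. Write $(v,\alpha)\lhd(u,\beta)$ if there is such a $p$ with $(v,\alpha)\to_p(u,\beta)$ and, moreover, for every vertex $x$, color $\tau$ and path $q$ with $(u,\beta)\to_q(x,\tau)$, the vertex $x$ does not occur in $p$. A set $P$ of vertex-color pairs dominates cusp-points if for every cusp-point $(v,\alpha)$, either $(v,\alpha)\in P$ or there is $(u,\beta)\in P$ with $(v,\alpha)\lhd(u,\beta)$. *)

(* Defs.v *)
From mathcomp Require Import all_boot.

Set Implicit Arguments.
Unset Strict Implicit.
Unset Printing Implicit Defensive.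

(* Finite undirected multigraphs in which an edge may have 0, 1 or 2
   endpoints. *)
Record partial_graph := PartialGraph {
  vertex : finType;
  edge : finType;
  ends : edge -> {set vertex};
  ends_le2 : forall e, #|ends e| <= 2 }.

(* Only the values [c e v] with [v \in ends e] are meaningful; everything below
   uses [c] on such pairs only. *)
Definition local_coloring (G : partial_graph) (C : finType) :=
  edge G -> vertex G -> C.

Section Paths.
Variable G : partial_graph.
Local Notation V := (vertex G).
Local Notation E := (edge G).

(* The alternating sequence (v_0, e_1, v_1, ..., e_n, v_n) is represented by its
   starting vertex v_0 and the list [:: (e_1, v_1); ...; (e_n, v_n)]. *)
Fixpoint is_path (v : V) (p : seq (E * V)) : bool :=
  if p is (e, w) :: p' then [&& v != w, ends e == [set v; w] & is_path w p']
  else true.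

Definition path_edges (p : seq (E * V)) : seq E := unzip1 p.

Definition path_vertices (v : V) (p : seq (E * V)) : seq V := v :: unzip2 p.

Definition path_target (v : V) (p : seq (E * V)) : V := last v (unzip2 p).

Definition closed_path (v : V) (p : seq (E * V)) : bool := v == path_target v p.

Definition open_path (v : V) (p : seq (E * V)) : bool := ~~ closed_path v p.

(* The only coincidence v_i = v_j allowed for i < j is v_0 = v_n. *)
Definition simple_path (v : V) (p : seq (E * V)) : Prop :=
  uniq (path_edges p) /\
  forall i j : nat, i < j -> j <= size p ->
    nth v (path_vertices v p) i = nth v (path_vertices v p) j ->
    i = 0 /\ j = size p.

Definition is_cycle (v : V) (p : seq (E * V)) : Prop :=
  [/\ is_path v p, simple_path v p, closed_path v p & p <> [::]].

(* The triples (e_i, v_i, e_{i+1}) for 0 < i < n, and (e_n, v_0, e_1) if the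
   path is closed. *)
Definition turns (v : V) (p : seq (E * V)) : seq (E * V * E) :=
  [seq (x.1.1, x.1.2, x.2.1) | x <- zip p (behead p)] ++
  (if p is (e1, _) :: p' then
     if closed_path v p then [:: (last e1 (path_edges p'), v, e1)] else [::]
   else [::]).

End Paths.

Section Coloring.
Variables (G : partial_graph) (C : finType) (c : local_coloring G C).
Local Notation V := (vertex G).
Local Notation E := (edge G).

Definition is_cusp (t : E * V * E) : bool :=
  let: (e, v, f) := t in
  [&& e != f, v \in ends e, v \in ends f & c e v == c f v].

Definition cusp_point (a : V * C) : Prop :=
  exists e f : E, is_cusp (e, a.1, f) /\ c e a.1 = a.2.

Definition cusp_of_path (v : V) (p : seq (E * V)) (t : E * V * E) : Prop :=
  t \in turns v p /\ is_cusp t.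

Definition cusp_free (v : V) (p : seq (E * V)) : Prop :=
  forall t : E * V * E, ~ cusp_of_path v p t.

(* [None] exactly when the path has no edge. *)
Definition starting_color (v : V) (p : seq (E * V)) : option C :=
  if p is (e1, _) :: _ then Some (c e1 v) else None.

Definition ending_color (p : seq (E * V)) : option C :=
  if p is x :: p' then let y := last x p' in Some (c y.1 y.2) else None.

Definition splitting (v : V) : Prop :=
  forall (w : V) (p : seq (E * V)), is_cycle w p -> v \in path_vertices w p ->
    exists e f : E, cusp_of_path w p (e, v, f).

(* (v, alpha) ->_p (u, beta), where p starts at v. Since p is open it has an
   edge, so its starting color is never [None]. *)
Definition arrow (a : V * C) (p : seq (E * V)) (b : V * C) : Prop :=
  [/\ is_path a.1 p /\ path_target a.1 p = b.1,
      simple_path a.1 p /\ open_path a.1 p,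
      cusp_free a.1 p,
      starting_color a.1 p <> Some a.2
    & ending_color p = Some b.2].

Definition tri (a b : V * C) : Prop :=
  exists p : seq (E * V), arrow a p b /\
    forall (x : V) (t : C) (q : seq (E * V)),
      arrow b q (x, t) -> x \notin path_vertices a.1 p.

Definition dominates_cusp_points (P : {set V * C}) : Prop :=
  forall a : V * C, cusp_point a ->
    a \in P \/ exists b : V * C, b \in P /\ tri a b.

(* [tri] is asymmetric: [tri b a] gives [arrow b q a], so the vertex of [a]
   could not occur in the path witnessing [tri a b], which starts there.
   Hence maximality means having no [tri]-successor. *)
Definition maximal_in (P : {set V * C}) (a : V * C) : Prop :=
  a \in P /\ forall b : V * C, b \in P -> ~ tri a b.

End Coloring.

(* Main.v *)
(* Suppose that some cycle through v has no cusp at v; orient it so that its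
   starting color at v is not alpha and take one with as few cusps as possible.
   It has a cusp, and the first one after v gives a cusp-point (u, beta) with
   (v, alpha) -> (u, beta). If an arrow from (u, beta) came back to the cycle,
   its part up to the first return would be an ear from u to some y. The ear makes
   a cycle with each of the two arcs between u and y, without cusp at u. At y, the
   two arcs and the ear cannot have cusps in both new cycles unless they have one
   in the old cycle. Hence one of the new cycles is cusp-free, or contains v, has
   no cusp at v and has fewer cusps than the old one. So (v, alpha) <| (u, beta),
   and since <| is transitive, (v, alpha) is not maximal in P. *)

Require Import Defs.
From mathcomp Require Import all_boot.
From mathcomp Require Import zify.

Set Implicit Arguments.
Unset Strict Implicit.
Unset Printing Implicit Defensive.

(** * Walks, cycles and ears as lists of darts *)

Section Walks.
Variable G : partial_graph.
Local Notation V := (vertex G).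
Local Notation E := (edge G).

(* A dart (v, e, w) is the edge e oriented from v to w: recording the source in
   each step makes walks easy to reverse and to rotate. *)
Definition dart : Type := V * E * V.
Definition src (d : dart) : V := d.1.1.
Definition dedge (d : dart) : E := d.1.2.
Definition tgt (d : dart) : V := d.2.
Definition flip (d : dart) : dart := (tgt d, dedge d, src d).
Definition valid (d : dart) := (src d != tgt d) && (ends (dedge d) == [set src d; tgt d]).

Implicit Types (s t : seq dart) (u v w : V).

Fixpoint walk u s v : bool :=
  if s is d :: s' then [&& src d == u, valid d & walk (tgt d) s' v] else u == v.

Definition rrev s : seq dart := rev (map flip s).

(** Listing sources counts the base point once. Distinct sources still allow going forth and back
    along one edge; distinct edges exclude this. *)
Definition dart_cycle u s : bool :=
  [&& s != [::], walk u s u, uniq (map src s) & uniq (map dedge s)].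

Definition undart s : seq (E * V) := [seq (dedge d, tgt d) | d <- s].

Lemma valid_ends d : valid d -> ends (dedge d) = [set src d; tgt d].
Proof. by case/andP=> _ /eqP. Qed.

Lemma valid_flip d : valid (flip d) = valid d.
Proof. by rewrite /valid /flip /src /tgt /dedge /= eq_sym setUC. Qed.

Lemma walk_valid u s v d : walk u s v -> d \in s -> valid d.
Proof.
elim: s u => //= a s IH u /and3P[_ va ws]; rewrite inE => /predU1P[->|] //.
exact: IH ws.
Qed.

Lemma walk_cat u s t v : walk u (s ++ t) v -> exists2 w, walk u s w & walk w t v.
Proof.
elim: s u => [|a s IH] u /=; first by exists u.
case/and3P=> au va /IH[w ws wt]; exists w => //; exact/and3P.
Qed.

Lemma cat_walk u s w t v : walk u s w -> walk w t v -> walk u (s ++ t) v.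
Proof.
elim: s u => [|a s IH] u /=; first by move/eqP->.
by case/and3P=> -> -> ws wt; rewrite IH.
Qed.

Lemma walk_inj u s v w : walk u s v -> walk u s w -> v = w.
Proof.
elim: s u => [|a s IH] u /=; first by move/eqP=> <- /eqP.
by case/and3P=> _ _ wv /and3P[_ _]; apply: IH wv.
Qed.

Lemma walk_srcE u s v : walk u s v -> rcons (map src s) v = u :: map tgt s.
Proof.
by elim: s u => [|a s IH] u /=; [move/eqP-> | case/and3P=> /eqP-> _ /IH->].
Qed.

Lemma walk_src u s v : walk u s v -> s != [::] -> u \in map src s.
Proof. by case: s => //= a s /andP[/eqP<-]; rewrite mem_head. Qed.

Lemma walk_rrev u s v : walk u s v -> walk v (rrev s) u.
Proof.
elim: s u => [|a s IH] u /=; first by rewrite eq_sym.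
case/and3P=> /eqP au va /IH ws; rewrite /rrev /= rev_cons -cats1.
by apply: cat_walk ws _; rewrite /= valid_flip va /flip /src /tgt /= !eqxx -au eqxx.
Qed.

Lemma src_rrev s : map src (rrev s) = rev (map tgt s).
Proof. by rewrite /rrev map_rev -map_comp. Qed.

Lemma dedge_rrev s : map dedge (rrev s) = rev (map dedge s).
Proof. by rewrite /rrev map_rev -map_comp. Qed.

Lemma rrev_nil s : (rrev s == [::]) = (s == [::]).
Proof. by rewrite -!size_eq0 size_rev size_map. Qed.

Lemma perm_tgt_src u s : walk u s u -> perm_eq (map tgt s) (map src s).
Proof. by move/walk_srcE=> H; rewrite -(perm_cons u) -H perm_rcons. Qed.

Lemma dart_cycle_rrev u s : dart_cycle u s -> dart_cycle u (rrev s).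
Proof.
case/and4P=> s0 ws us es.
rewrite /dart_cycle rrev_nil s0 walk_rrev // src_rrev dedge_rrev !rev_uniq es.
by rewrite (perm_uniq (perm_tgt_src ws)) us.
Qed.

Lemma dart_cycle_rot u s w t :
  dart_cycle u (s ++ t) -> walk u s w -> dart_cycle w (t ++ s).
Proof.
case/and4P=> s0 wst us es ws; have [w' ws' wt] := walk_cat wst.
rewrite -(walk_inj ws ws') in wt.
rewrite /dart_cycle (cat_walk wt ws) !map_cat !(uniq_catC (map _ t)) -!map_cat us es.
by rewrite -size_eq0 size_cat addnC -size_cat size_eq0 s0.
Qed.

Lemma split_src u s v x : walk u s v -> x \in map src s ->
  exists s1 s2, [/\ s = s1 ++ s2, walk u s1 x, walk x s2 v & s2 != [::]].
Proof.
move=> ws /mapP[d ds ->]; case/splitPr: ds ws => s1 s2.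
case/walk_cat=> w w1 w2; exists s1, (d :: s2); split=> //.
  by case/andP: (w2) => /eqP->.
by case/andP: (w2) => /eqP->.
Qed.

(** The start of a walk is an endpoint of its first edge, so a later use of that edge would visit
    the start again. *)
Lemma uniq_dedge u s v : walk u s v -> uniq (u :: map tgt s) -> uniq (map dedge s).
Proof.
elim: s u => //= a s IH u /and3P[/eqP au va ws] /andP[us ut].
rewrite (IH _ ws) // andbT; apply/mapP => -[d ds ed].
have: u \in ends (dedge a) by rewrite valid_ends // au set21.
rewrite ed (valid_ends (walk_valid ws ds)) => ud; case/negP: us; move: ud.
rewrite !inE => /orP[] /eqP->; last by rewrite map_f ?orbT.
by rewrite -in_cons -(walk_srcE ws) mem_rcons inE map_f ?orbT.
Qed.

(** [behead] drops the start [u], and the end [y] enters as the last target rather than as a source,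
    so only inner vertices of [q] have to avoid [s]. *)
Definition ear s u q y : bool :=
  [&& q != [::], walk u q y, uniq (map src q), uniq (map dedge q),
      all (fun x => x \notin map src s) (behead (map src q))
    & all (fun e => e \notin map dedge s) (map dedge q)].

(** The ear may replace either arc between [u] and [y]: [x1] by [q], or [x2] by the reverse of
    [q]. *)
Lemma ear_cycles u y x1 x2 q :
  dart_cycle u (x1 ++ x2) -> walk u x1 y -> x1 != [::] -> x2 != [::] ->
  ear (x1 ++ x2) u q y ->
  dart_cycle u (q ++ x2) /\ dart_cycle u (x1 ++ rrev q).
Proof.
case/and4P=> _ w us es w1 n1 n2 /and5P[nq wq uq eq /andP[dq deq]].
have [y' w1' w2] := walk_cat w; rewrite -(walk_inj w1 w1') in w2 => {w1' y'}.
move: us es; rewrite !map_cat !cat_uniq => /and3P[us1 us12 us2] /and3P[es1 es12 es2].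
have u1 := walk_src w1 n1; have y2 := walk_src w2 n2.
have eqE x : x \in map dedge q -> (x \notin map dedge x1) && (x \notin map dedge x2).
  by move/(allP deq); rewrite map_cat mem_cat negb_or.
have sqE x : x \in behead (map src q) -> (x \notin map src x1) && (x \notin map src x2).
  by move/(allP dq); rewrite map_cat mem_cat negb_or.
have hq : map src q = u :: behead (map src q).
  by case: (q) nq wq => //= d q' _ /andP[/eqP->].
split; apply/and4P; split.
- by case: (q) nq.
- exact: cat_walk wq w2.
- rewrite map_cat cat_uniq uq us2 andbT; apply/hasPn => x x2x.
  rewrite hq inE negb_or; apply/andP; split.
    by apply: contraNneq us12 => xu; apply/hasP; exists x; rewrite // xu.
  by apply/negP => /sqE; rewrite x2x andbF.
- rewrite map_cat cat_uniq eq es2 andbT; apply/hasPn => x x2x.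
  by apply/negP => /eqE; rewrite x2x andbF.
- by case: (x1) n1.
- exact: cat_walk w1 (walk_rrev wq).
- rewrite map_cat src_rrev cat_uniq us1 rev_uniq.
  (* The sources of the reversed ear are the targets of [q]: its inner vertices and [y]. *)
  have tq : perm_eq (map tgt q) (y :: behead (map src q)).
    rewrite -(perm_cons u) -(walk_srcE wq) hq /= perm_cons.
    by rewrite perm_rcons.
  have uyq : uniq (y :: behead (map src q)).
    move: uq; rewrite hq /= => /andP[_ ->]; rewrite andbT.
    by apply/negP => /sqE; rewrite y2 andbF.
  rewrite (perm_uniq tq) uyq andbT; apply/hasPn => x.
  rewrite mem_rev (perm_mem tq) inE => /predU1P[->|/sqE/andP[]//].
  by apply: contra us12 => y1; apply/hasP; exists y.
- rewrite map_cat dedge_rrev cat_uniq es1 rev_uniq eq andbT.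
  by apply/hasPn => x; rewrite mem_rev => /eqE/andP[].
Qed.

(** * Translation between paths and walks of darts *)

Lemma is_path_undart u p : is_path u p ->
  exists2 s, p = undart s & walk u s (path_target u p).
Proof.
elim: p u => [|[e w] p IH] u /=; first by exists [::]; rewrite //= /path_target.
case/and3P=> uw eE /IH[s -> ws]; exists ((u, e, w) :: s) => //=.
by rewrite eqxx /valid uw eE.
Qed.

Lemma undart_path u s v : walk u s v -> is_path u (undart s).
Proof.
elim: s u => //= a s IH u /and3P[/eqP<- /andP[-> ->]] /=; exact: IH.
Qed.

Lemma undart_vertices u s : path_vertices u (undart s) = u :: map tgt s.
Proof. by rewrite /path_vertices /undart /unzip2 -map_comp. Qed.

Lemma undart_edges s : path_edges (undart s) = map dedge s.
Proof. by rewrite /path_edges /undart /unzip1 -map_comp. Qed.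

Lemma undart_target u s v : walk u s v -> path_target u (undart s) = v.
Proof.
rewrite /path_target /unzip2 -map_comp.
by elim: s u => [|a s IH] u /=; [move/eqP | case/and3P=> _ _ /IH].
Qed.

(** The one coincidence tolerated by [simple_path], first vertex equal to last, contradicts
    [u != v]; distinct edges come from [uniq_dedge]. *)
Lemma undart_simple_open u s v : walk u s v -> u != v ->
  simple_path u (undart s) <-> uniq (u :: map tgt s).
Proof.
move=> ws uv; rewrite /simple_path undart_edges undart_vertices size_map; split.
- case=> _ inj; apply/(uniqP u) => i j; rewrite !inE [size _]/= size_map !ltnS.
  have nn : nth u (u :: map tgt s) (size s) = v.
    by rewrite -(walk_srcE ws) nth_rcons size_map ltnn eqxx.
  move=> li lj eij; case: (ltngtP i j) => // [lt|lt].
    by have [i0 js] := inj _ _ lt lj eij; move: eij; rewrite i0 js nn /= => /eqP; rewrite (negbTE uv).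
  by have [i0 js] := inj _ _ lt li (esym eij); move: eij; rewrite i0 js nn /= => /eqP; rewrite eq_sym (negbTE uv).
- move=> us; split; first exact: uniq_dedge ws us.
  move=> i j lt lj /eqP; rewrite nth_uniq //= ?size_map; lia.
Qed.

Lemma undart_simple_closed u s : walk u s u ->
  simple_path u (undart s) <-> uniq (map src s) && uniq (map dedge s).
Proof.
move=> ws; rewrite /simple_path undart_edges undart_vertices size_map -(walk_srcE ws).
split.
- case=> -> inj; rewrite andbT; apply/(uniqP u) => i j; rewrite !inE size_map.
  move=> li lj eij; have := inj i j; have := inj j i.
  have nE k : k < size s -> nth u (rcons (map src s) u) k = nth u (map src s) k.
    by move=> lk; rewrite nth_rcons size_map lk.
  rewrite !nE // eij => /(_ _ _ erefl) h /(_ _ _ erefl) h'; lia.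
- case/andP=> us ->; split=> // i j lt lj.
  have li : i < size s by lia.
  rewrite !nth_rcons !size_map li; case: ltnP => [lj'|lj'].
    move/eqP; rewrite nth_uniq ?size_map //; lia.
  (* Position [size s] holds [u], already the source of the first dart, so distinct sources force
     [i = 0]. *)
  have -> : j = size s by lia.
  rewrite eqxx; case: (s) ws us li => //= a s' /andP[/eqP<- _] /andP[ns us] li.
  case: i {lt} li => //= i; rewrite ltnS => li eq; case/negP: ns.
  by rewrite -eq mem_nth ?size_map.
Qed.

Lemma dart_cycle_is_cycle u s : dart_cycle u s -> is_cycle u (undart s).
Proof.
case/and4P=> s0 ws us es; split.
- exact: undart_path ws.
- by apply/undart_simple_closed => //; rewrite us.
- by rewrite /closed_path (undart_target ws).
- by case: (s) s0.
Qed.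

Lemma is_cycle_dart u p : is_cycle u p -> exists2 s, p = undart s & dart_cycle u s.
Proof.
case=> /is_path_undart[s -> ws] sp cp p0.
move: ws; rewrite -(eqP cp) => ws; exists s => //.
rewrite /dart_cycle ws; move/undart_simple_closed: sp => /(_ ws) ->.
by case: (s) p0.
Qed.

End Walks.

(** * Colors at the ends of walks, and counting cusps *)

Section Cusps.
Variables (G : partial_graph) (C : finType) (c : local_coloring G C).
Local Notation V := (vertex G).
Local Notation E := (edge G).
Implicit Types (s t q : seq (dart G)) (u v w : V).

Definition start_col s : option C :=
  if s is d :: _ then Some (c (dedge d) (src d)) else None.

Fixpoint end_col s : option C :=
  if s is d :: s' then
    if s' is [::] then Some (c (dedge d) (tgt d)) else end_col s'
  else None.

(** A cusp where [s] meets [t], judged by colors alone; the distinctness of edges required by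
    [is_cusp] is supplied by uniqueness of edges. For a cycle, [junction s s] is the closing cusp.
    The test against [None] keeps two empty walks from matching. *)
Definition junction s t : bool := (end_col s != None) && (end_col s == start_col t).

Fixpoint ncusps s : nat :=
  if s is d :: s' then junction [:: d] s' + ncusps s' else 0.

Lemma start_col_cat s t : start_col (s ++ t) = if s is [::] then start_col t else start_col s.
Proof. by case: s. Qed.

Lemma end_col_cat s t : end_col (s ++ t) = if t is [::] then end_col s else end_col t.
Proof.
elim: s => [|d s IH] /=; first by case: t.
by rewrite IH; case: t {IH} => [|a t]; case: s.
Qed.

Lemma end_colN s : (end_col s == None) = (s == [::]).
Proof. by elim: s => //= d [|a s]. Qed.

Lemma start_colN s : (start_col s == None) = (s == [::]).
Proof. by case: s. Qed.

Lemma start_col_rrev s : start_col (rrev s) = end_col s.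
Proof.
elim: s => //= d s; rewrite /rrev /= rev_cons -cats1 start_col_cat.
case: s => [|a s] //= <-.
by case: rev (size_rev (map (@flip _) (a :: s))).
Qed.

Lemma rrevK s : rrev (rrev s) = s.
Proof.
rewrite /rrev map_rev revK -map_comp -[RHS]map_id.
by apply: eq_map => -[[]].
Qed.

Lemma end_col_rrev s : end_col (rrev s) = start_col s.
Proof. by rewrite -start_col_rrev rrevK. Qed.

Lemma ncusps_cat s t : ncusps (s ++ t) = ncusps s + junction s t + ncusps t.
Proof.
elim: s => //= d s ->; rewrite /junction /= start_col_cat.
by case: s => [|a s] //=; rewrite -/(end_col (a :: s)); lia.
Qed.

Lemma ncusps_rrev s : ncusps (rrev s) = ncusps s.
Proof.
elim: s => //= d s IH; rewrite /rrev /= rev_cons -cats1 ncusps_cat -/(rrev s) IH.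
have -> : junction (rrev s) [:: flip d] = junction [:: d] s.
  by rewrite /junction end_col_rrev /=; case: (start_col s) => //= a; rewrite eq_sym.
have -> : ncusps [:: flip d] = 0 by [].
lia.
Qed.

Definition path_turns (p : seq (E * V)) : seq (E * V * E) :=
  [seq (x.1.1, x.1.2, x.2.1) | x <- zip p (behead p)].

Lemma ncusps_turns u s v : walk u s v -> uniq (map (@dedge G) s) ->
  ncusps s = count (is_cusp c) (path_turns (undart s)).
Proof.
elim: s u => //= d [|e s] IH u // /andP[du /andP[vd ws]] /andP[nd us].
change (junction [:: d] (e :: s) + ncusps (e :: s) =
  is_cusp c (dedge d, tgt d, dedge e) + count (is_cusp c) (path_turns (undart (e :: s)))).
rewrite (IH _ ws us).
case/andP: ws => /eqP es /andP[ve _].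
congr (nat_of_bool _ + _); rewrite /junction /=.
move: nd; rewrite inE negb_or => /andP[-> _] /=.
by rewrite (valid_ends vd) (valid_ends ve) -es set21 set22 es.
Qed.

Lemma turns_closed u s : dart_cycle u s ->
  exists2 t, turns u (undart s) = rcons (path_turns (undart s)) t
    & t.1.2 = u /\ is_cusp c t = junction s s.
Proof.
case/and4P=> s0 ws us es; rewrite /turns /closed_path (undart_target ws) eqxx.
case: s s0 ws us es => // d s _ ws us es /=.
exists (last (dedge d) (path_edges (undart s)), u, dedge d); first by rewrite cats1.
split=> //; rewrite undart_edges.
have [s' [e Es]] : exists s' e, d :: s = rcons s' e by exists (belast d s), (last d s); rewrite -lastI.
have -> : last (dedge d) (map (@dedge G) s) = dedge e.
  by rewrite last_map; have := congr1 (last d) Es; rewrite /= last_rcons => ->.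
have /= /andP[/eqP sd /andP[vd _]] := ws.
move: (ws); rewrite {1}Es -cats1 => /walk_cat[w _ /=]; rewrite andbA => /andP[/andP[_ ve] /eqP te].
(* A cycle of one dart would be a loop, which [valid] forbids; a longer one has distinct first and
   last edges. *)
have ned : dedge e != dedge d.
  case: s' Es => [[de _]|a s' [_ s_eq]].
    by move: vd; rewrite /valid sd de te eqxx.
  by move: es; rewrite s_eq map_cons map_rcons /= mem_rcons inE eq_sym; case: eqP.
rewrite /junction; have -> : end_col (d :: s) = Some (c (dedge e) (tgt e)).
  by rewrite Es -cats1 end_col_cat.
by rewrite /= ned (valid_ends vd) (valid_ends ve) sd te set21 set22.
Qed.

Lemma cusp_freeE u p : cusp_free c u p <-> count (is_cusp c) (turns u p) = 0.
Proof.
split.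
- by move=> cf; apply/eqP; rewrite -leqn0 leqNgt -has_count; apply/hasP => -[t tp ct]; apply: (cf t).
- by move=> n0 t [tp ct]; have : has (is_cusp c) (turns u p) by [apply/hasP; exists t]; rewrite has_count n0.
Qed.

Lemma cusp_free_cycle u s : dart_cycle u s ->
  cusp_free c u (undart s) <-> ncusps s + junction s s = 0.
Proof.
move=> cs; have /and4P[_ ws _ es] := cs.
have [t tE [_ ct]] := turns_closed cs.
rewrite cusp_freeE tE -cats1 count_cat /= addn0 ct -(ncusps_turns ws es).
by split.
Qed.

Lemma cusp_free_open u s v : walk u s v -> u != v -> uniq (map (@dedge G) s) ->
  cusp_free c u (undart s) <-> ncusps s = 0.
Proof.
move=> ws uv es; rewrite cusp_freeE /turns /closed_path (undart_target ws) (negbTE uv).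
rewrite (ncusps_turns ws es) count_cat.
have -> : (if undart s is (_, _) :: _ then [::] else [::]) = [::] :> seq (E * V * E).
  by case: (undart s) => // -[].
by rewrite addn0.
Qed.

Lemma path_turns_mem s d e t :
  (dedge d, tgt d, dedge e) \in path_turns (undart (s ++ d :: e :: t)).
Proof.
elim: s => [|a s IH]; first exact: mem_head.
by move: IH; case: s => [|b s] /= IH; rewrite /path_turns /= inE; apply/orP; right.
Qed.

(** Rotating the cycle to start at [v] turns its passage through [v] into the closing junction. *)
Lemma no_cusp_at w p v : is_cycle w p -> v \in path_vertices w p ->
  ~~ has (fun t : E * V * E => (t.1.2 == v) && is_cusp c t) (turns w p) ->
  exists2 s, dart_cycle v s & ~~ junction s s.
Proof.
case/is_cycle_dart=> s -> cs; rewrite undart_vertices => vs nc.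
have /and4P[s0 ws us es] := cs.
have {}vs : v \in map (@src G) s.
  move: vs; rewrite inE => /predU1P[->|]; first exact: walk_src ws s0.
  by rewrite (perm_mem (perm_tgt_src ws)).
have [s1 [s2 [sE w1 w2 n2]]] := split_src ws vs.
rewrite sE in cs; exists (s2 ++ s1); first exact: dart_cycle_rot w1.
have [t tE [tv tc]] := turns_closed cs; rewrite -sE in tE tc.
(* If [s1] is empty, [v] is the base point and its turn is the closing one; otherwise the turn joins
   the last dart of [s1] to the first of [s2]. *)
case: (lastP s1) => [|s1' d] in sE w1 cs *.
  rewrite cats0 -[s2]sE -tc; apply/negP => ct; case/negP: nc; apply/hasP.
  by exists t; rewrite ?tE ?mem_rcons ?mem_head // tv ct andbT.
case: s2 => // e s2 in n2 sE w2 cs *.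
rewrite /junction -cats1 catA end_col_cat /=; apply/negP => /eqP[cE].
case/negP: nc; apply/hasP; exists (dedge d, tgt d, dedge e).
  by rewrite tE mem_rcons inE sE -cats1 -catA path_turns_mem orbT.
have [w' w1' /= /and3P[/eqP dw vd /eqP dv]] : exists2 w', walk w s1' w' & walk w' [:: d] v.
  by apply: walk_cat; rewrite cats1.
case/andP: w2 => /eqP ev /andP[ve _]; rewrite dv eqxx /=.
rewrite (valid_ends vd) (valid_ends ve) ev dv set21 set22 -{2}ev -cE dv eqxx !andbT.
move: es; rewrite sE map_cat map_rcons cat_uniq => /and3P[_ /hasPn/(_ (dedge e)) h _].
by have := h (mem_head _ _); rewrite mem_rcons inE negb_or eq_sym => /andP[].
Qed.

(** * Arrows, and transitivity of [tri] *)

Definition dart_arrow (a : V * C) s (b : V * C) : bool :=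
  [&& walk a.1 s b.1, s != [::], uniq (a.1 :: map (@tgt G) s), ncusps s == 0,
      start_col s != Some a.2 & end_col s == Some b.2].

Lemma walk_end_tgt u s v : walk u s v -> s != [::] -> v \in map (@tgt G) s.
Proof.
case: (lastP s) => // s' d; rewrite -cats1 => /walk_cat[w _ /=].
by case/and3P=> _ _ /eqP<- _; rewrite map_cat mem_cat mem_head orbT.
Qed.

(** Pairwise distinct vertices on a nonempty walk express simple and open at once. *)
Lemma arrowE a p b : arrow c a p b <-> exists2 s, p = undart s & dart_arrow a s b.
Proof.
have colE s v : walk a.1 s v ->
    starting_color c a.1 (undart s) = start_col s /\
    ending_color c (undart s) = end_col s.
  case: s => //= d s /andP[/eqP-> _]; split=> //.
  by rewrite last_map; elim: s d => //= e s IH d; apply: IH.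
split.
- case=> -[/is_path_undart[s -> ws]] tb [sp op] cf sc ec; rewrite tb in ws.
  move: op; rewrite /open_path /closed_path tb => ab.
  have [cE1 cE2] := colE _ _ ws; rewrite cE1 cE2 in sc ec.
  exists s => //; move/(undart_simple_open ws ab): sp => us.
  move/(cusp_free_open ws ab (uniq_dedge ws us)): cf => n0.
  rewrite /dart_arrow ws us n0 ec !eqxx !andbT /=; apply/andP; split; last exact/eqP.
  by case: (s) ec.
- case=> s -> /and5P[ws s0 us /eqP n0 /andP[/eqP sc /eqP ec]].
  have [cE1 cE2] := colE _ _ ws.
  have ab : a.1 != b.1.
    by case/andP: (us) => na _; apply: contraNneq na => ->; apply: walk_end_tgt ws s0.
  split; rewrite ?cE1 ?cE2 //.
  + by split; [apply: undart_path ws | apply: undart_target].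
  + split; first by apply/(undart_simple_open ws ab).
    by rewrite /open_path /closed_path (undart_target ws).
  + by apply/(cusp_free_open ws ab (uniq_dedge ws us)).
Qed.

(** The color of the new target is read off the last dart kept. This allows stopping an arrow at any
    vertex it visits. *)
Lemma dart_arrow_prefix a q1 q2 b : dart_arrow a (q1 ++ q2) b -> q1 != [::] ->
  exists b', dart_arrow a q1 b'.
Proof.
case/and5P=> /walk_cat[y wq1 wq2] _ uq nq /andP[sq eq] n1.
have : end_col q1 != None by rewrite end_colN.
case ecq: (end_col q1) => [g|] // _; exists (y, g).
rewrite /dart_arrow wq1 n1 ecq eqxx andbT /=.
move: uq; rewrite map_cat -cat_cons cat_uniq => /andP[/= -> _] /=.
move: nq sq; rewrite ncusps_cat start_col_cat; case: (q1) n1 => // d q _.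
by rewrite !addn_eq0 -andbA => /andP[-> _] ->.
Qed.

(* By taking prefixes, the condition on the targets of the arrows from b extends
   to all their vertices but b.1. *)
Lemma triE a b : tri c a b <-> exists2 s, dart_arrow a s b
  & forall q x, dart_arrow b q x ->
      ~~ has (mem (a.1 :: map (@tgt G) s)) (map (@tgt G) q).
Proof.
split.
- case=> p [/arrowE[s -> sab] h]; exists s => // q x qbx.
  apply/hasPn => y /mapP[d dq ->].
  case/splitPr: dq qbx => q1 q2; rewrite -cat_rcons => /dart_arrow_prefix.
  case=> [|[z g] qz]; first by case: q1.
  have -> : tgt d = z.
    case/andP: qz; rewrite -cats1 => /walk_cat[w _ /= ] /and3P[_ _ /eqP //].
  have := h z g (undart (rcons q1 d)); rewrite undart_vertices; apply.
  by apply/arrowE; exists (rcons q1 d).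
- case=> s sab h; exists (undart s); split; first by apply/arrowE; exists s.
  move=> x t _ /arrowE[q _ qbx]; rewrite undart_vertices.
  have /hasPn := h _ _ qbx; apply; case/and3P: qbx => wq q0 _.
  exact: (walk_end_tgt wq q0).
Qed.

(** There is no cusp at the join: [s] ends with color [b.2], and [t] does not start with it. *)
Lemma dart_arrow_cat a s b t d : dart_arrow a s b -> dart_arrow b t d ->
  ~~ has (mem (a.1 :: map (@tgt G) s)) (map (@tgt G) t) -> dart_arrow a (s ++ t) d.
Proof.
case/and5P=> ws s0 us /eqP ns /andP[ss es].
case/and5P=> wt t0; rewrite cons_uniq => /andP[_ ut] /eqP nt /andP[st et] dis.
rewrite /dart_arrow (cat_walk ws wt) map_cat -cat_cons cat_uniq us ut dis.
rewrite ncusps_cat ns nt start_col_cat end_col_cat /junction (eqP es) (eq_sym _ (start_col t)) (negbTE st).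
by case: (s) (t) s0 t0 ss et => [|? ?] // [|? ?] // _ _ -> ->.
Qed.

(** An arrow [q] leaving [d] avoids [t], so [t ++ q] is an arrow leaving [b]; hence [t ++ q], and
    with it [q], avoids [s]. *)
Lemma tri_trans a b d : tri c a b -> tri c b d -> tri c a d.
Proof.
move=> /triE[s sab hs] /triE[t tbd ht]; apply/triE.
have st := hs _ _ tbd; exists (s ++ t); first exact: dart_arrow_cat tbd st.
move=> q x qdx; have qt := ht _ _ qdx.
have tq := dart_arrow_cat tbd qdx qt.
have := hs _ _ tq; rewrite map_cat has_cat negb_or => /andP[_ qs].
apply/hasPn => y yq; move/hasPn: qs => /(_ _ yq); move/hasPn: qt => /(_ _ yq).
by rewrite /= map_cat !inE mem_cat !negb_or => /andP[_ ->] /andP[-> ->].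
Qed.

(** * Ears leaving a cusp, and reduction of the number of cusps *)

Lemma first_cusp s : 0 < ncusps s ->
  exists s1 s2, [/\ s = s1 ++ s2, ncusps s1 = 0 & junction s1 s2].
Proof.
elim: s => //= d s IH; case J: (junction [:: d] s).
  by exists [:: d], s.
case/IH=> s1 [s2 [sE n1 J12]]; exists (d :: s1), s2; rewrite sE; split=> //=.
  rewrite n1 addn0; move: J; rewrite sE /junction start_col_cat.
  by case: (s1) J12 => //= ? ? _ ->.
by move: J12; rewrite /junction /=; case: (s1).
Qed.

Lemma start_col_src u s v d : walk u s v -> uniq (map (@src G) s) ->
  d \in s -> src d = u -> start_col s = Some (c (dedge d) u).
Proof.
case: s => // e s /andP[/eqP eu _] /andP[ns _]; rewrite inE => /predU1P[-> <-//|ds du].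
by case/negP: ns; rewrite eu -du map_f.
Qed.

Lemma end_col_tgt u s d : dart_cycle u s ->
  d \in s -> tgt d = u -> end_col s = Some (c (dedge d) u).
Proof.
move/dart_cycle_rrev/and4P=> [_ ws us _] ds du; rewrite -start_col_rrev.
apply: (@start_col_src _ _ u (flip d)) => //.
by rewrite mem_rev map_f.
Qed.

(** The ear is the part of [q] up to its first return to the cycle; it ends away from [u] because an
    arrow never revisits its start. *)
Lemma arrow_ear u s b q x :
  dart_cycle u s -> start_col s = Some b -> end_col s = Some b ->
  dart_arrow (u, b) q x -> x.1 \in map (@src G) s ->
  exists y q1, [/\ ear s u q1 y, y \in map (@src G) s, y != u, ncusps q1 = 0
                 & start_col q1 != Some b].
Proof.
move=> cs; have /and4P[s0 ws us es] := cs; move=> scs ecs qx xs.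
have hq : has (fun d => tgt d \in map (@src G) s) q.
  have /and3P[wq q0 _] := qx; have /mapP[d dq xd] := walk_end_tgt wq q0.
  by apply/hasP; exists d; rewrite -?xd.
case/split_find: {q} hq qx => d q1 q2 dS q1S /dart_arrow_prefix.
case=> [|[y g]]; first by case: q1 {q1S}.
case/and5P=> /= wq q0 uq /eqP nq /andP[sq _].
have yd : tgt d = y by move: wq; rewrite -cats1 => /walk_cat[w _ /=] /and3P[_ _ /eqP].
have sE : map (@src G) (rcons q1 d) = u :: map (@tgt G) q1.
  have := walk_srcE wq; rewrite [map (@tgt G) _]map_rcons yd -rcons_cons; exact: rcons_injl.
exists y, (rcons q1 d); split=> //; last 1 first.
- by case/andP: uq; rewrite map_rcons yd mem_rcons inE eq_sym negb_or => /andP[].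
- rewrite /ear q0 wq (uniq_dedge wq uq) sE /=.
  move: uq; rewrite -cons_uniq map_rcons -rcons_cons rcons_uniq => /andP[_ uq].
  rewrite -cons_uniq uq /=.
  have q1S' : all (fun z => z \notin map (@src G) s) (map (@tgt G) q1).
    by apply/allP => z /mapP[e eq ->]; move/hasPn: q1S; apply.
  (* A shared edge has both endpoints on the cycle, so before the first return it must leave [u]. On
     the cycle it is then the first or the last edge, of color [b] at [u], whereas the arrow does
     not start with [b]. *)
  rewrite q1S' /=; apply/allP => e /mapP[f fq ->{e}].
  apply/mapP => -[f' fs' ef].
  have vf := walk_valid wq fq; have vf' := walk_valid ws fs'.
  have srcS : src f \in map (@src G) s.
    have : src f \in ends (dedge f) by rewrite valid_ends // set21.
    rewrite ef valid_ends // !inE => /orP[] /eqP->; first exact: map_f.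
    by rewrite -(perm_mem (perm_tgt_src ws)) map_f.
  have srcu : src f = u.
    have := map_f (@src G) fq; rewrite sE inE => /predU1P[//|/(allP q1S')].
    by rewrite srcS.
  have uqs : uniq (map (@src G) (rcons q1 d)) by rewrite sE.
  have sf := start_col_src wq uqs fq srcu.
  have : u \in ends (dedge f') by rewrite -ef valid_ends // -srcu set21.
  rewrite valid_ends // !inE => /orP[] /eqP uf'.
    by move: sq; rewrite sf ef -(start_col_src ws us fs' (esym uf')) scs eqxx.
  by move: sq; rewrite sf ef -(end_col_tgt cs fs' (esym uf')) ecs eqxx.
- by rewrite -yd.
Qed.

(** Minimality of the number of cusps becomes induction on a bound for [ncusps s]. Each smaller
    cycle through [v] keeps the first and last colors of [s], so a closing cusp of it is one of
    [s]. *)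
Lemma junction_of_no_tri_cusp_point v a s :
  (forall w t, dart_cycle w t -> ncusps t + junction t t != 0) ->
  (forall b, cusp_point c b -> ~ tri c (v, a) b) ->
  dart_cycle v s -> start_col s != Some a -> junction s s.
Proof.
move=> noCF noTri; have [n] := ubnP (ncusps s); elim: n s => // n IH s.
rewrite ltnS => sn cs sa; apply/negPn/negP => Js.
have /and4P[s0 ws us es] := cs.
have: 0 < ncusps s by have := noCF _ _ cs; rewrite (negbTE Js) addn0 lt0n.
(* With no closing cusp, some cusp lies inside; [s1] leads from [v] to the first one, at [u] with
   color [b]. *)
case/first_cusp=> s1 [s2 [sE n1 J12]].
have [u w1 w2] : exists2 u, walk v s1 u & walk u s2 v by apply: walk_cat; rewrite -sE.
have s1N : s1 != [::] by rewrite -end_colN; case/andP: J12.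
have [b ec1] : exists b, end_col s1 = Some b.
  by move: s1N; rewrite -end_colN; case: end_col => // b; exists b.
have sc2 : start_col s2 = Some b by case/andP: J12 => _ /eqP<-.
have s2N : s2 != [::] by rewrite -start_colN sc2.
have cs21 : dart_cycle u (s2 ++ s1) by rewrite sE in cs; exact: dart_cycle_rot w1.
have sc21 : start_col (s2 ++ s1) = Some b by rewrite start_col_cat; case: (s2) s2N sc2.
have ec21 : end_col (s2 ++ s1) = Some b by rewrite end_col_cat; case: (s1) s1N ec1.
have memS : map (@src G) (s2 ++ s1) =i map (@src G) s.
  by move=> x; rewrite sE !map_cat !mem_cat orbC.
have us1 : uniq (v :: map (@tgt G) s1).
  rewrite -(walk_srcE w1) rcons_uniq; move: us; rewrite sE map_cat cat_uniq.
  case/and3P=> -> /hasPn h _; rewrite andbT; apply: h; exact: walk_src w2 s2N.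
have u2 := walk_src w2 s2N.
have scs : start_col s = start_col s1 by rewrite sE start_col_cat; case: (s1) s1N.
have ecs : end_col s = end_col s2 by rewrite sE end_col_cat; case: (s2) s2N.
have nsE : ncusps s = (ncusps s2).+1 by rewrite sE ncusps_cat n1 J12.
(* First [(u, b)] is shown to be a cusp-point, then [s1] to witness [tri]. *)
apply: (noTri (u, b)).
  have [t1 [d sE1]] : exists t1 d, s1 = rcons t1 d.
    by case: (lastP s1) s1N => // t1 d _; exists t1, d.
  have [e [t2 sE2]] : exists e t2, s2 = e :: t2.
    by case: (s2) s2N => // e t2 _; exists e, t2.
  have du : tgt d = u.
    by move: w1; rewrite sE1 -cats1 => /walk_cat[w _ /= /and3P[_ _ /eqP]].
  have eu : src e = u by move: w2; rewrite sE2 => /andP[/eqP].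
  have vd : valid d by apply: walk_valid w1 _; rewrite sE1 mem_rcons mem_head.
  have ve : valid e by apply: walk_valid w2 _; rewrite sE2 mem_head.
  have de : dedge d != dedge e.
    move: es; rewrite sE sE1 sE2 map_cat map_rcons cat_uniq.
    case/and3P=> _ /hasPn/(_ (dedge e) (mem_head _ _)) h _.
    by move: h; rewrite /= mem_rcons inE negb_or eq_sym => /andP[].
  move: ec1 sc2; rewrite sE1 sE2 -cats1 end_col_cat /= du eu => -[cd] [ce].
  exists (dedge d), (dedge e); rewrite /= cd ce de eqxx.
  by rewrite (valid_ends vd) (valid_ends ve) du eu set21 set22.
apply/triE; exists s1.
  by rewrite /dart_arrow w1 s1N us1 n1 ec1 -scs sa !eqxx.
move=> q x qx; apply/hasPn => z zq; apply/negP => zs1.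
have {q x qx z zq zs1} [y [q [eq yS yu nq sq]]] : exists y q,
    [/\ ear (s2 ++ s1) u q y, y \in map (@src G) (s2 ++ s1), y != u, ncusps q = 0
      & start_col q != Some b].
  move: zq => /mapP[f fq zf]; case/splitPr: fq qx => q1 q2.
  rewrite -cat_rcons => /dart_arrow_prefix; case=> [|z' qz']; first by case: q1.
  have zE : z'.1 = z.
    case/andP: qz'; rewrite -cats1 => /walk_cat[w _ /= /and3P[_ _ /eqP <-]] _.
    by rewrite zf.
  apply: arrow_ear cs21 sc21 ec21 qz' _.
  rewrite zE memS; move: zs1; rewrite /= -(walk_srcE w1) mem_rcons inE.
  by rewrite sE map_cat mem_cat => /predU1P[->|->//]; rewrite u2 orbT.
have /and3P[qN wq _] := eq.
(* The ear makes no cusp at [u]: both cycle edges there have color [b], its own first edge does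
   not. *)
have JqL t : end_col t = Some b -> junction t q = false.
  by rewrite /junction => ->; rewrite (eq_sym _ (start_col q)) (negbTE sq).
have JqR t : start_col t = Some b -> junction (rrev q) t = false.
  by rewrite /junction => ->; rewrite end_col_rrev (negbTE sq) andbF.
move: yS; rewrite map_cat mem_cat => /orP[y2|y1].
(* Here [y] is on [s2], and [s1 ++ q ++ b2] passes through [v] and loses the cusp at [u]. If it
   gains one between [q] and [b2], then [a2 ++ rrev q], not being cusp-free, forces a cusp inside
   [a2] or between [a2] and [b2], which is lost as well. *)
- have [a2 [b2 [sE2 wa wb bN]]] := split_src w2 y2.
  have aN : a2 != [::] by apply: contraNneq yu => a0; rewrite a0 /= eq_sym in wa.
  have sca : start_col a2 = Some b by rewrite -sc2 sE2 start_col_cat; case: (a2) aN.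
  have bsN : b2 ++ s1 != [::] by case: (b2) bN.
  rewrite sE2 -catA in cs21 eq.
  have [c1 c2] := ear_cycles cs21 wa aN bsN eq.
  have scq : junction q (b2 ++ s1) -> junction a2 (rrev q) = junction a2 b2.
    rewrite /junction start_col_rrev start_col_cat => /andP[_ /eqP->].
    by case: (b2) bN.
  have := noCF _ _ c2; rewrite ncusps_cat ncusps_rrev nq addn0.
  have -> : junction (a2 ++ rrev q) (a2 ++ rrev q) = false.
    rewrite /junction end_col_cat start_col_cat.
    case rq: (rrev q) => [|f r]; first by move: (rrev_nil q); rewrite rq (negbTE qN).
    rewrite -rq end_col_rrev; case: (a2) aN sca => // ? ? _ ->.
    by rewrite (negbTE sq) andbF.
  rewrite addn0 => nq2.
  rewrite catA in c1; have {}c1 := dart_cycle_rot c1 (cat_walk wq wb).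
  have scE : start_col (s1 ++ q ++ b2) = start_col s.
    by rewrite scs start_col_cat; case: (s1) s1N.
  have ecE : end_col (s1 ++ q ++ b2) = end_col s.
    by rewrite ecs sE2 catA !end_col_cat; case: (b2) bN.
  have J1 : junction s1 (q ++ b2) = false.
    by rewrite -(JqL s1 ec1) /junction start_col_cat; case: (q) qN.
  case: (ltnP (ncusps (s1 ++ q ++ b2)) n) => [lt|].
    by case/negP: Js; rewrite /junction -scE -ecE; apply: IH c1 _; last by rewrite scE.
  rewrite !ncusps_cat n1 J1 nq; move: sn; rewrite nsE sE2 ncusps_cat.
  case Jqb: (junction q b2) => sn; last by move: sn; clear; lia.
  move: nq2; rewrite scq; first by case: (junction a2 b2) sn; clear; lia.
  by move: Jqb; rewrite /junction start_col_cat; case: (b2) bN.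
(* Here [y] is on [s1]. As [b1] has no cusp, the cycle [q ++ b1] must have its cusp at [y], so [q]
   ends with the starting color of [b1]. Replacing [b1] by the reversed ear then removes the cusp at
   [u] and adds none at [y]. *)
- have [a1 [b1 [sE1 wa wb bN]]] := split_src w1 y1.
  rewrite sE1 catA in cs21 eq.
  have saN : s2 ++ a1 != [::] by case: (s2) s2N.
  have [c1 c2] := ear_cycles cs21 (cat_walk w2 wa) saN bN eq.
  have ecb : end_col b1 = Some b by rewrite -ec1 sE1 end_col_cat; case: (b1) bN.
  move: n1; rewrite sE1 ncusps_cat => n1.
  have Jqb : junction q b1.
    have := noCF _ _ c1; rewrite ncusps_cat nq.
    have -> : junction (q ++ b1) (q ++ b1) = false.
      rewrite /junction end_col_cat start_col_cat.
      case: (b1) bN ecb => // f r _ ->; case: (q) qN sq => // g p _ sq.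
      by rewrite (eq_sym _ (start_col (g :: p))) (negbTE sq) andbF.
    by move: n1 => /eqP; rewrite addn_eq0 => /andP[_ /eqP->]; case: junction.
  have scr : start_col (rrev q) = start_col b1.
    by rewrite start_col_rrev; case/andP: Jqb => _ /eqP.
  have rN : rrev q != [::] by rewrite rrev_nil.
  rewrite -catA in c2; have {}c2 := dart_cycle_rot c2 w2.
  (* If [y] is [v], then [a1] is empty and the starting color is preserved by [scr]. *)
  have scE : start_col ((a1 ++ rrev q) ++ s2) = start_col s.
    rewrite sE sE1 !start_col_cat; case: (a1) => //.
    by case: (rrev q) rN scr; case: (b1) bN.
  have ecE : end_col ((a1 ++ rrev q) ++ s2) = end_col s.
    by rewrite ecs end_col_cat; case: (s2) s2N.
  case/negP: Js; rewrite /junction -scE -ecE; apply: IH c2 _; last by rewrite scE.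
  rewrite !ncusps_cat ncusps_rrev nq.
  have -> : junction (a1 ++ rrev q) s2 = false.
    by rewrite -(JqR s2 sc2) /junction end_col_cat; case: (rrev q) rN.
  have -> : junction a1 (rrev q) = junction a1 b1 by rewrite /junction scr.
  by move: sn n1; rewrite nsE; case: (junction a1 b1); clear; lia.
Qed.

End Cusps.

(** * From maximality to splitting *)

Theorem theorem3p6 (G : partial_graph) (C : finType) (c : local_coloring G C)
    (P : {set vertex G * C})
    (hP : dominates_cusp_points c P)
    (hG : ~ exists (w : vertex G) (p : seq (edge G * vertex G)),
        is_cycle w p /\ cusp_free c w p) :
  forall (v : vertex G) (alpha : C),
    maximal_in c P (v, alpha) -> splitting c v.
Proof.
move=> v a [vP vmax] w p cp vp.
have [/hasP[[[e x] f] tp /andP[/= /eqP xv ct]]|nc] :=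
  boolP (has (fun t : edge G * vertex G * edge G => (t.1.2 == v) && is_cusp c t) (turns w p)).
  by rewrite xv in tp ct; exists e, f.
have [s cs Js] := no_cusp_at cp vp nc.
have noCF u t : dart_cycle u t -> ncusps c t + junction c t t != 0.
  move=> ct; apply/eqP => n0; apply: hG; exists u, (undart t).
  by split; [apply: dart_cycle_is_cycle | apply/cusp_free_cycle].
(* Domination and transitivity extend maximality within [P] to all cusp-points: a [tri]-successor
   outside [P] has itself a successor in [P]. *)
have noTri b : cusp_point c b -> ~ tri c (v, a) b.
  case/hP=> [bP|[b' [b'P bb']]]; first exact: vmax.
  by move/tri_trans/(_ bb'); apply: vmax.
(* If the cycle starts with [a], it is traversed backwards: having no cusp at [v], it does not end
   with [a]. *)
case: (eqVneq (start_col c s) (Some a)) => [sa|sa]; last first.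
  by rewrite (junction_of_no_tri_cusp_point noCF noTri cs sa) in Js.
have sr : start_col c (rrev s) != Some a.
  by rewrite start_col_rrev; apply: contraNneq Js => ea; rewrite /junction ea sa eqxx.
have := junction_of_no_tri_cusp_point noCF noTri (dart_cycle_rrev cs) sr.
case/andP=> _; rewrite end_col_rrev start_col_rrev sa => /eqP ea.
by rewrite /junction -ea sa eqxx in Js.
Qed.
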